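(* Let $d\ge1$ and let $P\subset\mathbb{R}^d$ be a minimal covering polytope. Then $P$ has at least $2d$ facets. Moreover, this bound is sharp, i.e. for every $d\ge 1$ there exists a minimal covering polytope in $\mathbb{R}^d$ with exactly $2d$ facets.
   Context: A convex body in $\mathbb{R}^d$ is a non-empty compact convex set; it is called covering if $K+\mathbb{Z}^d=\mathbb{R}^d$. A convex body is minimal covering if it is covering and no convex body $K'\subsetneq K$ is covering. A minimal covering polytope is a polytope that is minimal covering. *)

(* Defs.v *)
From HB Require Import structures.
From mathcomp Require Import all_boot all_order all_algebra.
From mathcomp Require Import all_classical all_reals all_analysis.

Set Implicit Arguments.
Unset Strict Implicit.
Unset Printing Implicit Defensive.

Import Order.TTheory GRing.Theory Num.Theory.
Import numFieldNormedType.Exports.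

Local Open Scope classical_set_scope.
Local Open Scope ring_scope.

Section Covering.
Variables (R : realType) (d : nat).
Implicit Types (K P F S : set 'rV[R]_d) (p x : 'rV[R]_d).

Definition convex_body K := [/\ K !=set0, compact K & convex_set K].

Definition integer_lattice : set 'rV[R]_d :=
  [set x | forall i, x ord0 i \is a Num.int].

Definition covering K :=
  [set x + z | x in K & z in integer_lattice] = [set: 'rV[R]_d].

Definition minimal_covering K :=
  [/\ convex_body K, covering K &
      forall K', convex_body K' -> K' `<` K -> ~ covering K'].

Definition convex_hull S : set 'rV[R]_d :=
  \bigcap_(C in [set C | convex_set C /\ S `<=` C]) C.

Definition polytope P :=
  exists S : set 'rV[R]_d, finite_set S /\ P = convex_hull S.

Definition flat p (V : {vspace 'rV[R]_d}) : set 'rV[R]_d :=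
  [set x | x - p \in V].

Definition affine_hull S : set 'rV[R]_d :=
  \bigcap_(A in [set A | (exists p V, A = flat p V) /\ S `<=` A]) A.

(* The empty set has no dimension: its affine hull is empty, hence not a flat. *)
Definition has_dim S (k : nat) :=
  exists p V, affine_hull S = flat p V /\ (\dim V = k)%N.

Definition dot p x : R := \sum_i p ord0 i * x ord0 i.

(* a = 0 is allowed, so P and the empty set are faces of P. *)
Definition face P F :=
  exists (a : 'rV[R]_d) (b : R),
    (forall x, P x -> dot a x <= b) /\ F = [set x | P x /\ dot a x = b].

Definition facet P F :=
  face P F /\ exists k, has_dim P k.+1 /\ has_dim F k.

Definition facets P : set (set 'rV[R]_d) := [set F | facet P F].

End Covering.

(* Main.v *)
Require Import Defs.
From HB Require Import structures.
From mathcomp Require Import all_boot all_order all_algebra.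
From mathcomp Require Import all_classical all_reals all_analysis.
From mathcomp Require Import ring lra zify.

(** Lower bound. Let [v] be a point of the minimal covering polytope [P] of
    maximal Euclidean norm. Cutting off a small cap of [P] around [v] destroys
    the covering property, so there are arbitrarily small [u] such that [v + u]
    is covered by [P] but by no other translate. If [v - z] lies in [P] for a
    lattice vector [z != 0], then [v - z + u] violates a facet inequality that
    is tight at [v - z]; its normal [a] satisfies [a.u > 0]. If some [w != 0]
    were orthogonal to all normals with [a.u > 0], then close to [v] the strip
    [v + l u + t w] would be covered by [P] alone, and [P] would contain a
    segment centred at [v] in the limit, contradicting the choice of [v]. Hence
    these normals span, and there are at least [d] of them. Likewise the facets
    through [v] have [a.u < 0], and their normals span because [v] is a vertex.
    This yields two disjoint families of [d] facets.

    Sharpness. The cube [0, 1]^d has 2d facets; its interior points are covered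
    by no other translate, so it is minimal covering. *)

Set Implicit Arguments.
Unset Strict Implicit.
Unset Printing Implicit Defensive.

Import Order.TTheory GRing.Theory Num.Theory.
Import numFieldNormedType.Exports.

Local Open Scope classical_set_scope.
Local Open Scope card_scope.

(** * The standard inner product on row vectors *)

Section Dot.
Local Open Scope ring_scope.
Variables (R : realType) (d : nat).
Implicit Types (p x y : 'rV[R]_d) (t : R).

Lemma dotC p x : dot p x = dot x p.
Proof. by apply: eq_bigr => i _; rewrite mulrC. Qed.

Lemma dot_linear p : linear_for *%R (dot p).
Proof.
move=> t x y; rewrite mulr_sumr -big_split; apply: eq_bigr => i _.
by rewrite !mxE mulrDr mulrCA.
Qed.

HB.instance Definition _ p :=
  GRing.isLinear.Build R 'rV[R]_d R *%R (dot p) (dot_linear p).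

Lemma dotDr p x y : dot p (x + y) = dot p x + dot p y.
Proof. exact: raddfD. Qed.

Lemma dotBr p x y : dot p (x - y) = dot p x - dot p y.
Proof. exact: raddfB. Qed.

Lemma dotNr p x : dot p (- x) = - dot p x.
Proof. exact: raddfN. Qed.

Lemma dotZr p t x : dot p (t *: x) = t * dot p x.
Proof. exact: linearZ. Qed.

Lemma dot0r p : dot p 0 = 0.
Proof. exact: raddf0. Qed.

Lemma dotDl p x y : dot (x + y) p = dot x p + dot y p.
Proof. by rewrite !(dotC _ p) dotDr. Qed.

Lemma dotBl p x y : dot (x - y) p = dot x p - dot y p.
Proof. by rewrite !(dotC _ p) dotBr. Qed.

Lemma dotNl p x : dot (- x) p = - dot x p.
Proof. by rewrite !(dotC _ p) dotNr. Qed.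

Lemma dotZl p t x : dot (t *: x) p = t * dot x p.
Proof. by rewrite !(dotC _ p) dotZr. Qed.

Lemma dot0l p : dot 0 p = 0.
Proof. by rewrite dotC dot0r. Qed.

Lemma dot_delta p i : dot p (delta_mx ord0 i) = p ord0 i.
Proof.
rewrite /dot (bigD1 i)//= big1 ?addr0 => [|j ji]; rewrite !mxE eqxx/=.
  by rewrite eqxx mulr1.
by rewrite (negPf ji) mulr0.
Qed.

Lemma sqr_coord_le_dot x i : x ord0 i ^+ 2 <= dot x x.
Proof.
rewrite /dot (bigD1 i)//= -expr2 lerDl; apply: sumr_ge0 => j _.
by rewrite -expr2 sqr_ge0.
Qed.

Lemma dot_ge0 x : 0 <= dot x x.
Proof. by apply: sumr_ge0 => i _; rewrite -expr2 sqr_ge0. Qed.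

Lemma dot_gt0 x : x != 0 -> 0 < dot x x.
Proof.
move=> x0; rewrite lt_neqAle dot_ge0 andbT eq_sym; apply: contraNneq x0 => xx0.
apply/eqP/rowP => i; rewrite mxE; apply/eqP; rewrite -sqrf_eq0.
by rewrite eq_le sqr_ge0 -xx0 sqr_coord_le_dot.
Qed.

Lemma dot_continuous p : continuous (dot p).
Proof.
apply: (@continuous_big R _ +%R 0 xpredT); first exact: add_continuous.
move=> i _ x.
have h : (y : 'rV[R]_d) ord0 i @[y --> x] --> x ord0 i.
  exact: coord_continuous.
exact: cvgM (cvg_cst _) h.
Qed.

End Dot.

(** * Farkas' lemma, with facet-defining certificates *)

Section Farkas.
Local Open Scope ring_scope.
Variables (R : realType) (n : nat).
Implicit Types (K : set 'rV[R]_n) (u c : 'rV[R]_n).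

Definition convex_cone K :=
  [/\ K 0, forall x y, K x -> K y -> K (x + y) &
      forall (t : R) x, 0 <= t -> K x -> K (t *: x)].

(** Induction on the number of generators: if the functional [a] separating [u] from the tail is
    positive on the head [g], project along [g] onto the hyperplane orthogonal to [a]. Quantifying
    over all cones containing the generators avoids tracking coefficients. *)
Lemma farkas (s : seq 'rV[R]_n) u :
  (forall K, convex_cone K -> {in s, forall x, K x} -> K u) \/
  exists c, {in s, forall x, dot c x <= 0} /\ 0 < dot c u.
Proof.
have [k] := ubnP (size s); elim: k s u => // k IH [|g s] u /=.
  have [->|u0] := eqVneq u 0; first by left => K [].
  by right; exists u; split=> //; exact: dot_gt0.
rewrite ltnS => sk; have [su|[a [sa ua]]] := IH s u sk.
  by left => K KK sK; apply: su => // x xs; apply: sK; rewrite inE xs orbT.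
have [ga|ga] := leP (dot a g) 0.
  by right; exists a; split=> // x; rewrite inE => /predU1P[->//|/sa].
pose pr x := x - (dot a x / dot a g) *: g.
have [|su|[b [sb ub]]] := IH (map pr s) (pr u); first by rewrite size_map.
- left => K KK sK; case: (KK) => K0 KD KZ.
  have Kg : K g by apply: sK; rewrite mem_head.
  have -> : u = pr u + (dot a u / dot a g) *: g by rewrite subrK.
  apply: (KD); last by apply: KZ => //; rewrite divr_ge0 ?ltW.
  (* On the tail [dot a x <= 0], so [pr x] is [x] plus a nonnegative multiple of [g]. *)
  apply: su => // _ /mapP[x xs ->]; rewrite /pr -scaleNr.
  apply: (KD); first by apply: sK; rewrite inE xs orbT.
  by apply: KZ => //; rewrite oppr_ge0 mulr_le0_ge0 ?invr_ge0 ?(ltW ga) ?sa.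
(* This functional is [b] composed with [pr]; it vanishes at [g]. *)
- right; exists (b - (dot b g / dot a g) *: a).
  have prE x : dot (b - (dot b g / dot a g) *: a) x = dot b (pr x).
    by rewrite dotBl dotZl dotBr dotZr; ring.
  split; last by rewrite prE.
  move=> x; rewrite inE => /predU1P[->|xs]; last by rewrite prE sb ?map_f.
  by rewrite prE /pr divff ?gt_eqF// scale1r subrr dot0r.
Qed.

(* A valid functional with a maximal set of tight generators defines a facet of
   the cone: any other functional vanishing on the tight generators could be
   added to it until one more generator becomes tight. *)
Lemma farkas_facet m (g : 'I_m -> 'rV[R]_n) u :
  (forall c, (forall i, dot c (g i) = 0) -> c = 0) ->
  (forall K, convex_cone K -> (forall i, K (g i)) -> K u) \/
  exists c, [/\ forall i, dot c (g i) <= 0, 0 < dot c u &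
    forall y, (forall i, dot c (g i) = 0 -> dot y (g i) = 0) ->
      exists k, y = k *: c].
Proof.
move=> span; have [su|[c0 [sc0 uc0]]] := farkas (codom g) u.
  by left => K KK gK; apply: su => // _ /codomP[i ->].
right; pose tight c := [set i | dot c (g i) == 0]%SET.
pose p k := `[< exists c, [/\ forall i, dot c (g i) <= 0, 0 < dot c u
  & #|tight c| = k] >].
have p0 : exists k, p k.
  exists #|tight c0|; apply/asboolP; exists c0; split=> // i.
  by rewrite sc0 ?codom_f.
have pm k : p k -> (k <= m)%N.
  by move=> /asboolP[c [_ _ <-]]; rewrite -[leqRHS]card_ord max_card.
have [k /asboolP[c [cg cu ck]] kmax] := ex_maxnP p0 pm.
exists c; split=> // y yt.
exists (dot y u / dot c u); apply/eqP; rewrite -subr_eq0; apply: contraT => y'0.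
(* Subtracting this multiple of [c] makes [y'] vanish at [u], so moving [c] along [y'] keeps its
   value at [u] positive. *)
set y' := y - _ in y'0.
have y'u : dot y' u = 0 by rewrite dotBl dotZl divfK ?gt_eqF// subrr.
have y't i : dot c (g i) = 0 -> dot y' (g i) = 0.
  by move=> ci; rewrite dotBl dotZl ci (yt _ ci) mulr0 subrr.
have [z [i0 [zu zt zi0]]] : exists z i0, [/\ dot z u = 0,
    forall i, dot c (g i) = 0 -> dot z (g i) = 0 & 0 < dot z (g i0)].
  have [i0] : exists i, dot y' (g i) != 0.
    apply/existsP; rewrite -[X in is_true X]negbK negb_exists.
    apply: contra y'0 => /forallP y'g; apply/eqP/span => i.
    by apply/eqP; rewrite -[_ == _]negbK y'g.
  case: ltgtP => // yi0 _; last by exists y', i0.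
  exists (- y'), i0; split; rewrite ?dotNl ?y'u ?oppr0 ?oppr_gt0//.
  by move=> i /y't; rewrite dotNl => ->; rewrite oppr0.
(* [F i] is the step along [z] at which generator [i] becomes tight; the smallest one preserves all
   inequalities and enlarges the tight set. *)
pose F i := (- dot c (g i)) / dot z (g i).
case: (@Order.TotalTheory.arg_minP _ R _ i0 (fun i => 0 < dot z (g i)) F zi0).
move=> i1 zi1 i1min.
have F0 : 0 <= F i1 by rewrite divr_ge0 ?oppr_ge0 ?cg ?ltW.
have c'E i : dot (c + F i1 *: z) (g i) = dot c (g i) + F i1 * dot z (g i).
  by rewrite dotDl dotZl.
have : p #|tight (c + F i1 *: z)|.
  apply/asboolP; exists (c + F i1 *: z); split=> //; last first.
    by rewrite dotDl dotZl zu mulr0 addr0.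
  move=> i; rewrite c'E; have [zi|zi] := ltP 0 (dot z (g i)).
    by rewrite -lerBrDl sub0r -ler_pdivlMr// i1min.
  by rewrite -[leRHS]addr0 lerD ?cg// mulr_ge0_le0.
move=> /kmax; rewrite -ck leqNgt => /negP[]; apply: proper_card.
apply/properP; split.
  apply/fintype.subsetP => i; rewrite !inE => /eqP ci.
  by rewrite c'E ci zt// mulr0 addr0.
exists i1; rewrite !inE; first by rewrite c'E /F divfK ?lt0r_neq0// subrr.
by apply: contraTN zi1 => /eqP/zt ->; rewrite ltxx.
Qed.

End Farkas.

(** * Facet inequalities of the convex hull of finitely many points *)

Section ConvexHull.
Local Open Scope ring_scope.
Variables (R : realType) (d : nat).
Implicit Types (K S : set 'rV[R]_d) (a x y : 'rV[R]_d) (t b c : R).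

Lemma convex_setP K : convex_set K <->
  forall x y t, K x -> K y -> 0 <= t <= 1 -> K (t *: x + (1 - t) *: y).
Proof.
split=> [cK x y t Kx Ky /andP[t0 t1]|cK x y t]; last first.
  rewrite !inE => Kx Ky; apply: cK => //.
  by apply/andP; split; [exact: ge0|exact: le1].
by have := cK x y (Itv01 t0 t1); rewrite !inE; apply.
Qed.

Lemma convex_halfspace a b : convex_set [set x | dot a x <= b].
Proof.
apply/convex_setP => x y t /= xb yb /andP[t0 t1]; rewrite dotDr !dotZr.
have := ler_wpM2l t0 xb; have : 0 <= 1 - t by lra.
move=> /ler_wpM2l /(_ _ _ yb); lra.
Qed.

Lemma convex_dot_ball c : convex_set [set x : 'rV[R]_d | dot x x <= c].
Proof.
apply/convex_setP => x y t /= xc yc /andP[t0 t1].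
have -> : dot (t *: x + (1 - t) *: y) (t *: x + (1 - t) *: y) =
    t * dot x x + (1 - t) * dot y y - t * (1 - t) * dot (x - y) (x - y).
  by rewrite !(dotDr, dotDl, dotNr, dotNl, dotZl, dotZr) (dotC y x); ring.
have : 0 <= t * (1 - t) * dot (x - y) (x - y).
  by rewrite !mulr_ge0 ?dot_ge0//; lra.
have := ler_wpM2l t0 xc; have : 0 <= 1 - t by lra.
move=> /ler_wpM2l /(_ _ _ yc); lra.
Qed.

Lemma sub_convex_hull S : S `<=` convex_hull S.
Proof. by move=> x Sx C [_]; apply. Qed.

Lemma convex_hull_min S K : convex_set K -> S `<=` K -> convex_hull S `<=` K.
Proof. by move=> cK SK x; apply; split. Qed.

(** Homogeneous coordinates: points sit at height 1, where the functional [homog b a] becomes the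
    affine function [b + dot a x]. *)
Definition homog t x : 'rV[R]_(1 + d) := row_mx t%:M x.

Lemma dot_homog b a t x : dot (homog b a) (homog t x) = b * t + dot a x.
Proof.
rewrite /dot big_split_ord/= big_ord1; congr (_ + _).
  by rewrite !row_mxEl !mxE !mulr1n.
by apply: eq_bigr => i _; rewrite !row_mxEr.
Qed.

Lemma homogP (u : 'rV[R]_(1 + d)) : exists t x, u = homog t x.
Proof.
exists (lsubmx u ord0 ord0), (rsubmx u); rewrite -[LHS]hsubmxK; congr row_mx.
exact: mx11_scalar.
Qed.

Lemma homog_inj t x t' x' : homog t x = homog t' x' -> t = t' /\ x = x'.
Proof.
move=> /eq_row_mx[/matrixP/(_ ord0 ord0) + ->].
by rewrite !mxE !mulr1n.
Qed.

Lemma homogD t x t' x' : homog t x + homog t' x' = homog (t + t') (x + x').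
Proof. by rewrite /homog add_row_mx raddfD. Qed.

Lemma homogZ t t' x' : t *: homog t' x' = homog (t * t') (t *: x').
Proof. by rewrite /homog scale_row_mx scale_scalar_mx. Qed.

Lemma homog00 : homog 0 0 = 0.
Proof. by rewrite /homog raddf0 row_mx0. Qed.

(* The last clause says, dually, that the tight points affinely span the
   hyperplane [dot f.1 x = f.2]. *)
Definition facet_ineq m (s : 'I_m -> 'rV[R]_d) (f : 'rV[R]_d * R) :=
  [/\ forall i, dot f.1 (s i) <= f.2, f.1 != 0 &
      forall y c, (forall i, dot f.1 (s i) = f.2 -> dot y (s i) = c) ->
        exists k, y = k *: f.1 /\ c = k * f.2].

Definition tight m (s : 'I_m -> 'rV[R]_d) (f : 'rV[R]_d * R) : {set 'I_m} :=
  [set i | dot f.1 (s i) == f.2]%SET.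

Definition affinely_spanning m (s : 'I_m -> 'rV[R]_d) :=
  forall a c, (forall i, dot a (s i) = c) -> a = 0.

(** Apply [farkas_facet] to the generators lifted to height 1. Cone membership at height 1 is
    membership in the hull, and a separating functional [homog b a] reads [dot a x <= - b]. *)
Lemma separating_facet m (s : 'I_m -> 'rV[R]_d) x :
  (0 < m)%N -> affinely_spanning s ->
  convex_hull (range s) x \/ exists2 f, facet_ineq s f & f.2 < dot f.1 x.
Proof.
move=> m0 span; pose i0 := Ordinal m0.
have spanh u : (forall i, dot u (homog 1 (s i)) = 0) -> u = 0.
  have [b [a ->]] := homogP u => h.
  have a0 : a = 0.
    apply: (span _ (- b)) => i; apply/eqP; rewrite -addr_eq0 addrC.
    by have := h i; rewrite dot_homog mulr1 => ->.
  have := h i0; rewrite dot_homog mulr1 a0 dot0l addr0 => ->.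
  exact: homog00.
have [xK|[c [cs cx cmax]]] := farkas_facet (homog 1 x) spanh.
- left=> C [cC sC].
  (* The cone over [C]; in the form [t *: y], height 0 contains only the origin. *)
  pose K (u : 'rV[R]_(1 + d)) :=
    exists t y, [/\ 0 <= t, C y & u = homog t (t *: y)].
  have [|i|t [y [_ Cy]]] := xK K; last first.
  + by move=> /homog_inj[<- ->]; rewrite scale1r.
  + by exists 1, (s i); rewrite scale1r; split=> //; apply: sC; exists i.
  split.
  + exists 0, (s i0); rewrite scale0r homog00; split=> //.
    by apply: sC; exists i0.
  + move=> _ _ [t [y [t0 Cy ->]]] [t' [y' [t'0 Cy' ->]]].
    rewrite homogD; have [tt'|tt'] := eqVneq (t + t') 0.
      exists 0, y; split=> //.
      have -> : t = 0 by lra.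
      have -> : t' = 0 by lra.
      by rewrite !scale0r !addr0.
    exists (t + t'), ((t / (t + t')) *: y + (1 - t / (t + t')) *: y').
    have tt0 : 0 < t + t' by rewrite lt_neqAle eq_sym tt' addr_ge0.
    split; first exact: addr_ge0.
      move/convex_setP: cC; apply=> //; apply/andP; split.
        by apply: divr_ge0 => //; exact: ltW.
      by rewrite ler_pdivrMr// mul1r lerDl.
    rewrite scalerDr !scalerA mulrBr mulr1 mulrCA divff// mulr1.
    by congr (homog _ (_ + _ *: _)); ring.
  + move=> t _ t0 [t' [y [t'0 Cy ->]]]; exists (t * t'), y.
    by rewrite homogZ scalerA mulr_ge0.
- right; have [b [a cE]] := homogP c; rewrite {}cE in cs cx cmax.
  have cs' i : b + dot a (s i) <= 0.
    by have := cs i; rewrite dot_homog mulr1.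
  move: cx; rewrite dot_homog mulr1 => cx.
  exists (a, - b) => /=; last by lra.
  split=> /= [i||y c' yt]; first by have := cs' i; lra.
    (* If [a = 0], a generator gives [b <= 0], against [0 < b]. *)
    by apply: contraTneq cx => a0; have := cs' i0; rewrite a0 !dot0l -leNgt.
  have [i|k] := cmax (homog (- c') y).
    rewrite !dot_homog !mulr1 => bs; rewrite (yt i); first by rewrite addNr.
    by lra.
  rewrite homogZ => /homog_inj[c'E ->]; exists k; split=> //.
  by rewrite mulrN -c'E opprK.
Qed.

(** The dual clause gives proportionality. The factor is positive because some generator is not
    tight, and both inequalities are strict there. *)
Lemma facet_ineq_tight_scale m (s : 'I_m -> 'rV[R]_d) f f' :
  affinely_spanning s -> facet_ineq s f -> facet_ineq s f' ->
  tight s f = tight s f' ->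
  exists2 k, 0 < k & f.1 = k *: f'.1 /\ f.2 = k * f'.2.
Proof.
move=> span [fs f0 _] [f's f'0 f'max] ff'.
have [i|k [fE1 fE2]] := f'max f.1 f.2.
  by move=> /eqP f'i; apply/eqP; move/setP/(_ i): ff'; rewrite !inE f'i.
exists k => //.
have [i f'i] : exists i, dot f'.1 (s i) != f'.2.
  apply/existsP; rewrite -[X in is_true X]negbK negb_exists.
  apply: contra f'0 => /forallP h; apply/eqP/(span _ f'.2) => i.
  by apply/eqP; rewrite -[_ == _]negbK h.
have : dot f'.1 (s i) < f'.2 by rewrite lt_neqAle f'i f's.
have : dot f.1 (s i) < f.2.
  rewrite lt_neqAle fs andbT; move/setP/(_ i): ff'; rewrite !inE => ->.
  exact: f'i.
rewrite fE1 fE2 dotZl => h1 h2; rewrite ltNge; apply/negP => k0.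
by move: h1; rewrite ltNge => /negP[]; apply: ler_wnM2l => //; exact: ltW.
Qed.

(** Facet inequalities with the same tight set are equivalent, so one representative per tight set
    suffices, and there are finitely many tight sets. *)
Lemma finite_facet_description m (s : 'I_m -> 'rV[R]_d) :
  (0 < m)%N -> affinely_spanning s ->
  exists (F : {set {set 'I_m}}) (f : {set 'I_m} -> 'rV[R]_d * R),
    (forall J, J \in F -> facet_ineq s (f J) /\ tight s (f J) = J) /\
    forall x, (forall J, J \in F -> dot (f J).1 x <= (f J).2) ->
      convex_hull (range s) x.
Proof.
move=> m0 span.
pose F := [set J : {set 'I_m} |
  `[< exists f, facet_ineq s f /\ tight s f = J >]]%SET.
have /choice[f fF] : forall J : {set 'I_m}, exists f, J \in F ->
    facet_ineq s f /\ tight s f = J.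
  move=> J; case: (boolP (J \in F)); last by exists (0, 0).
  by rewrite inE => /asboolP[f fJ]; exists f.
exists F, f; split=> // x xF; have [//|[g gs gx]] := separating_facet x m0 span.
have gF : tight s g \in F by rewrite inE; apply/asboolP; exists g.
have [fs ft] := fF _ gF.
have [k k0 [fE1 fE2]] := facet_ineq_tight_scale span fs gs ft.
have := xF _ gF; rewrite fE1 fE2 dotZl ler_pM2l// leNgt.
by rewrite gx.
Qed.

End ConvexHull.

(** * Affine hulls, dimension, and facets *)

Section Flats.
Local Open Scope ring_scope.
Variables (R : realType) (d : nat).
Implicit Types (S P : set 'rV[R]_d) (V W : {vspace 'rV[R]_d}).
Implicit Types (a x y p q : 'rV[R]_d).

(** The functional is a column of the cokernel matrix of a basis of [V]. *)
Lemma vspace_annihilator V x : x \notin V ->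
  exists a, (forall y, y \in V -> dot a y = 0) /\ dot a x != 0.
Proof.
pose M : 'M[R]_(\dim V, d) := \matrix_i (vbasis V)`_i.
have inV y : (y \in V) = (y <= M)%MS.
  apply/idP/idP => [/coord_vbasis->|/submxP[D ->]].
    rewrite summx_sub// => i _; apply: scalemx_sub.
    by rewrite -[X in (X <= _)%MS](rowK (fun i => (vbasis V)`_i)) row_sub.
  rewrite mulmx_sum_row memv_suml// => i _; rewrite memvZ// rowK.
  by rewrite vbasis_mem// mem_nth// size_tuple.
have dotM y j : dot (col j (cokermx M))^T y = (y *m cokermx M) ord0 j.
  by rewrite mxE; apply: eq_bigr => i _; rewrite !mxE mulrC.
rewrite inV submxE => /rV0Pn[j xj].
exists (col j (cokermx M))^T; split=> [y|]; rewrite dotM//.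
by rewrite inV submxE => /eqP->; rewrite mxE.
Qed.

Lemma hyperplane_vspace a : a != 0 ->
  exists V, (forall x, (x \in V) = (dot a x == 0)) /\ (\dim V).+1 = d.
Proof.
move=> a0; exists (lker (linfun (dot a : 'rV[R]_d -> R^o))); split=> [x|].
  by rewrite memv_ker lfunE.
have := limg_ker_dim (linfun (dot a : 'rV[R]_d -> R^o)) fullv.
rewrite capfv dimvf /dim/= mul1n => dE; rewrite -[RHS]dE -addn1.
congr (_ + _)%N.
apply/esym/eqP; rewrite eqn_leq; apply/andP; split.
  by rewrite (leq_trans (dimvS (subvf _)))// dimvf.
rewrite lt0n dimv_eq0; apply: contra_neq a0 => /eqP.
rewrite -subv0 => /subvP/(_ (linfun (dot a : 'rV[R]_d -> R^o) a)).
rewrite memv_img ?memvf// memv0 lfunE => /(_ isT)/eqP /= aa0.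
by apply/eqP; apply: contraT => /dot_gt0; rewrite aa0 ltxx.
Qed.

Lemma flat_inj p q V W : flat p V = flat q W -> V = W.
Proof.
move=> pVqW.
have h x : (x \in V) = (x + p - q \in W).
  have : flat p V (x + p) <-> flat q W (x + p) by rewrite pVqW.
  by rewrite /flat/= addrK => -[h1 h2]; apply/idP/idP.
have pq : p - q \in W by rewrite -[p]add0r -h mem0v.
by apply/vspaceP => x; rewrite h -addrA rpredDr.
Qed.

Lemma has_dim_inj S k k' : has_dim S k -> has_dim S k' -> k = k'.
Proof.
move=> [p [V [SV <-]]] [q [W [SW <-]]]; congr (\dim _).
by apply: (@flat_inj p q); rewrite -SV.
Qed.

Lemma has_dim_full P :
  (forall a c, (forall x, P x -> dot a x = c) -> a = 0) -> has_dim P d.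
Proof.
move=> span; exists 0, fullv; rewrite dimvf /dim/= mul1n; split=> //.
rewrite eqEsubset; split=> x _; first exact: memvf.
move=> _ [[p [V ->]] PV]; rewrite /flat/=; apply: contraT.
move=> /vspace_annihilator[a [aV]].
rewrite (span a (dot a p)) ?dot0l ?eqxx// => y /PV/aV.
by rewrite dotBr => /subr0_eq.
Qed.

(** The affine hull of the face is the whole hyperplane: a functional constant on a flat containing
    the face is a multiple of [f.1] by the dual clause, so it cannot separate a point of the
    hyperplane from that flat. *)
Lemma facet_of_facet_ineq m (s : 'I_m -> 'rV[R]_d) f :
  affinely_spanning s -> facet_ineq s f ->
  facet (convex_hull (range s))
    [set x | convex_hull (range s) x /\ dot f.1 x = f.2].
Proof.
move=> span [fs f0 fmax]; set P := convex_hull _; set F := [set x | _].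
have Ps i : P (s i) by apply: sub_convex_hull; exists i.
split.
  exists f.1, f.2; split=> //.
  apply: convex_hull_min; first exact: convex_halfspace.
  by move=> _ [i _ <-]; exact: fs.
have [V [VE dV]] := hyperplane_vspace f0.
exists (\dim V); split.
  rewrite dV; apply: has_dim_full => a c Pa; apply: (span _ c) => i.
  exact: Pa.
(* Without tight points, the dual clause would apply vacuously to [y = 0], [c = 1] and give
   [1 = 0]. *)
have [i0 fi0] : exists i, dot f.1 (s i) = f.2.
  apply: contrapT => ntight; have [i fi|k []] := fmax 0 1.
    by case: ntight; exists i.
  move=> /esym/eqP; rewrite scaler_eq0 (negPf f0) orbF => /eqP-> /eqP.
  by rewrite mul0r oner_eq0.
exists (s i0), V; split=> //; rewrite eqEsubset; split=> x.
  apply; split; first by exists (s i0), V.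
  by move=> y [_ fy]; rewrite /flat/= VE dotBr fy fi0 subrr.
rewrite /flat/= VE dotBr fi0 subr_eq0 => /eqP fx _ [[q [W ->]] FW].
rewrite /flat/=; apply: contraT => /vspace_annihilator[a [aW]].
have [i fi|k [aE qE]] := fmax a (dot a q); last first.
  by rewrite dotBr qE {1}aE dotZl fx subrr eqxx.
by apply/eqP; rewrite -subr_eq0 -dotBr; apply/eqP/aW/FW.
Qed.

End Flats.

(** * Lattice coverings *)

Section Covering.
Local Open Scope ring_scope.
Variables (R : realType) (d : nat).
Implicit Types (K : set 'rV[R]_d) (a x z : 'rV[R]_d).

Lemma integer_latticeP z :
  integer_lattice z <-> exists y : 'rV[int]_d, z = map_mx intr y.
Proof.
split=> [zi|[y ->] i]; last by rewrite mxE intr_int.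
exists (\row_i Num.floor (z ord0 i)); apply/rowP => i.
by rewrite !mxE floorK.
Qed.

Lemma coveringP K : covering K <->
  forall x, exists2 z, integer_lattice z & K (x - z).
Proof.
split=> [cK x|cK]; last first.
  apply/seteqP; split=> // x _; have [z zi Kz] := cK x.
  by exists (x - z) => //; exists z => //; rewrite subrK.
have : [set: 'rV[R]_d] x by [].
by rewrite -cK => -[y Ky [z zi <-]]; exists z; rewrite ?addrK.
Qed.

(* A hyperplane has only countably many translates by lattice vectors, and each
   meets a transversal line in one point. *)
Lemma covering_spanning K a (c : R) :
  covering K -> (forall x, K x -> dot a x = c) -> a = 0.
Proof.
move=> /coveringP cK Ka; apply/eqP; apply: contraT => /rV0Pn[i ai].
(* The parameter at which the [i]-th coordinate axis meets the hyperplane translated by [y]. *)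
pose h (y : 'rV[int]_d) : R := (c + dot a (map_mx intr y)) / a ord0 i.
have hc : countable `[0, 1 : R]%classic.
  apply: (@sub_countable _ _ _ [set: 'rV[int]_d]); last exact: countableP.
  apply: card_le_trans (card_image_le h setT); apply: subset_card_le => t _.
  have [_ /integer_latticeP[y ->] /Ka] := cK (t *: delta_mx ord0 i).
  rewrite dotBr dotZr dot_delta => tE; exists y => //.
  by rewrite /h -tE subrK mulfK.
have := countable_lebesgue_measure0 hc.
rewrite lebesgue_measure_itv/= lte_fin ltr01 oppr0 adde0 => -[]/eqP.
by rewrite oner_eq0.
Qed.

End Covering.

(** * The covering in a small neighbourhood of a point *)

Section Local.
Local Open Scope ring_scope.
Variables (R : realType) (d : nat).
Implicit Types (P : set 'rV[R]_d) (u v w x z : 'rV[R]_d).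

Lemma bounded_integer_lattice (M : R) :
  exists (I : finType) (g : I -> 'rV[R]_d), forall z, integer_lattice z ->
    (forall i, `|z ord0 i| <= M) -> exists k, z = g k.
Proof.
pose K := Num.bound `|M|.
exists 'rV['I_(K + K).+1]_d.
exists (map_mx (fun k : 'I_(K + K).+1 => k%:R - K%:R : R)).
move=> _ /integer_latticeP[y ->] yM.
exists (\row_i inord (absz (y ord0 i + K%:Z))).
apply/rowP => i; rewrite !mxE.
have : `|(y ord0 i)%:~R : R| < K%:R.
  have := yM i; rewrite mxE => /le_lt_trans; apply.
  by rewrite (le_lt_trans (ler_norm _))// archi_boundP.
rewrite -[K%:R]/(K%:Z%:~R) -intr_norm ltr_int ltr_norml => /andP[yK Ky].
have yK0 : 0 <= y ord0 i + K%:Z by lia.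
rewrite inordK; last by lia.
by rewrite -[(absz _)%:R]/((absz _)%:Z%:~R) gez0_abs// intrD addrK.
Qed.

Lemma near0_coord (U : set 'rV[R]_d) : (\forall u \near (0 : 'rV[R]_d), U u) ->
  exists2 r : R, 0 < r & forall u, (forall i, `|u ord0 i| < r) -> U u.
Proof.
move=> /nbhs_ballP[r /= r0 rU]; exists r => // u ur; apply: rU; split=> // i j.
by rewrite ord1 !mxE /ball/= sub0r normrN.
Qed.

Lemma near0_translate x (U : set 'rV[R]_d) :
  nbhs x U -> \forall u \near (0 : 'rV[R]_d), U (x + u).
Proof.
move=> xU; have xu : x + u @[u --> (0 : 'rV[R]_d)] --> x.
  by rewrite -[X in _ --> X]addr0; exact: (cvgD (cvg_cst _) cvg_id).
exact: xu.
Qed.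

Lemma near_right_affine_lt (p q c : R) : p < c ->
  \forall t \near 0^'+, p + t * q < c.
Proof.
move=> pc; near=> t.
have : t * (`|q| + 1) < c - p.
  rewrite -ltr_pdivlMr; last by rewrite ltr_wpDl.
  by near: t; apply: nbhs_right_lt; rewrite divr_gt0 ?subr_gt0 ?ltr_wpDl.
have : t * q <= t * (`|q| + 1).
  by rewrite ler_wpM2l// (le_trans (ler_norm q))// lerDl.
lra.
Unshelve. all: by end_near. Qed.

Lemma near_right_coord_lt u w (r : R) : (forall i, `|u ord0 i| < r) ->
  \forall t \near 0^'+, forall i, `|(u + t *: w) ord0 i| < r.
Proof.
move=> ur; apply: filter_forall => i.
have := ur i; rewrite ltr_norml ltrNl => /andP[ur1 ur2].
near=> t; rewrite !mxE ltr_norml ltrNl opprD -mulrN; apply/andP.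
by split; near: t; exact: near_right_affine_lt.
Unshelve. all: by end_near. Qed.

(** Since [P] is bounded, only finitely many [v - z] can reach it by a perturbation with coordinates
    below 1. For each of these the conditions are open in [u], so one radius serves every [z]. *)
Lemma local_structure P (I : finType) (f : I -> 'rV[R]_d * R) v :
  compact P -> exists2 r : R, 0 < r & forall u, (forall i, `|u ord0 i| < r) ->
    forall z, integer_lattice z ->
    (~ P (v - z) -> ~ P (v - z + u)) /\
    (P (v - z) -> forall k, dot (f k).1 (v - z) < (f k).2 ->
       dot (f k).1 (v - z + u) < (f k).2).
Proof.
move=> cP; have clP := compact_closed (@norm_hausdorff _ _) cP.
have [B [_ PB]] := compact_bounded cP.
have coord x i : `|x ord0 i| <= `|x|.
  rewrite -[leRHS]/(mx_norm x) mx_normrE; apply/bigmax_geP; right => /=.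
  by exists (ord0, i).
have {}PB x i : P x -> `|x ord0 i| <= B + 1.
  by move=> Px; apply: le_trans (coord x i) (PB (B + 1) _ x Px); rewrite ltrDl.
(* The three terms bound [v], the perturbation [u'] and the point [v - z + u'] of [P]. *)
have [J [g gP]] := bounded_integer_lattice (`|v| + 1 + (B + 1)).
pose Q z u := (~ P (v - z) -> ~ P (v - z + u)) /\
  (P (v - z) -> forall k, dot (f k).1 (v - z) < (f k).2 ->
       dot (f k).1 (v - z + u) < (f k).2).
have [r r0 rQ] : exists2 r : R, 0 < r & forall u, (forall i, `|u ord0 i| < r) ->
    forall k, Q (g k) u.
  apply: (@near0_coord (fun u => forall k, Q (g k) u)).
  apply: (@filter_forall _ J (fun k => Q (g k)) (nbhs (0 : 'rV[R]_d))) => k.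
  pose x := v - g k.
  apply: filterI.
    have [Px|nPx] := pselect (P x); first by near=> u.
    have oP : nbhs x (~` P).
      by apply: open_nbhs_nbhs; split=> //; exact: closed_openC.
    by apply: filterS (near0_translate oP).
  have [Px|nPx] := pselect (P x); last by near=> u => /nPx.
  pose slack k' u :=
    dot (f k').1 x < (f k').2 -> dot (f k').1 (x + u) < (f k').2.
  suff h : \forall u \near (0 : 'rV[R]_d), forall k', slack k' u.
    by apply: filterS h => u h _; exact: h.
  apply: (@filter_forall _ I slack (nbhs (0 : 'rV[R]_d))) => k'; rewrite /slack.
  have [fx|fx] := ltP (dot (f k').1 x) (f k').2; last by near=> u.
  have h : nbhs x [set y | dot (f k').1 y < (f k').2].
    exact: (dot_continuous (lt_nbhsl fx)).
  by apply: filterS (near0_translate h).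
exists (Num.min r 1); first by rewrite lt_min r0 ltr01.
move=> u ur z zi.
have ur1 i : `|u ord0 i| < r by have := ur i; rewrite lt_min => /andP[].
have u1 i : `|u ord0 i| < 1 by have := ur i; rewrite lt_min => /andP[].
have [[k ->]|zJ] := pselect (exists k, z = g k); first exact: rQ.
have far u' : (forall i, `|u' ord0 i| < 1) -> ~ P (v - z + u').
  move=> u'1 Pz; apply: zJ; apply: gP => // i.
  have -> : z ord0 i = v ord0 i + u' ord0 i - (v - z + u') ord0 i.
    by rewrite !mxE; ring.
  rewrite (le_trans (ler_normB _ _))// lerD ?PB//.
  by rewrite (le_trans (ler_normD _ _))// lerD// ltW.
split=> [_|Pz]; first exact: far.
case: (@far 0); last by rewrite addr0.
by move=> i; rewrite mxE normr0.
Unshelve. all: by end_near. Qed.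

(** By minimality, the body [P'] left after cutting off a cap at [v] misses some [x] modulo the
    lattice. All representatives of [x] in [P] then lie in the cap, which is too small to hold
    two. *)
Lemma privately_covered_near P v (r : R) :
  minimal_covering P -> P v -> (forall x, P x -> dot x x <= dot v v) ->
  (exists2 x, P x & dot v x < dot v v) -> 0 < r ->
  exists u, [/\ forall i, `|u ord0 i| < r, P (v + u) &
    forall z, integer_lattice z -> P (v + u - z) -> z = 0].
Proof.
move=> [[_ cP cvP] /coveringP covP minP] Pv vmax [x0 Px0 vx0] r0.
(* With [r' <= 1/2], two points of the cap differ by less than 1 in each coordinate. *)
pose r' := Num.min r (2^-1).
have r'0 : 0 < r' by rewrite lt_min r0 invr_gt0 ltr0n.
(* The first bound makes the cap small, as [dot (x - v) (x - v) <= 2 * (dot v v - dot v x)] on [P];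
   the second keeps [x0] in [P']. *)
pose e := Num.min (r' ^+ 2 / 4) (dot v v - dot v x0).
have e0 : 0 < e by rewrite lt_min subr_gt0 vx0 divr_gt0// exprn_gt0.
have er : e <= r' ^+ 2 / 4 by rewrite ge_min lexx.
have ex : e <= dot v v - dot v x0 by rewrite ge_min lexx orbT.
pose P' := P `&` [set x | dot v x <= dot v v - e].
have near_v x : P x -> ~ P' x -> forall i, `|(x - v) ord0 i| < r'.
  move=> Px nP'x i; have vx : dot v v - e < dot v x.
    by rewrite ltNge; apply/negP => h; apply: nP'x.
  have h : dot (x - v) (x - v) < r' ^+ 2.
    rewrite dotBl !dotBr (dotC x v); have := vmax _ Px.
    have := exprn_gt0 2 r'0; lra.
  rewrite -ltr_sqr ?nnegrE ?normr_ge0 ?ltW// real_normK ?num_real//.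
  exact: le_lt_trans (sqr_coord_le_dot _ _) h.
have /minP : convex_body P'.
  split; first by exists x0; split=> //=; lra.
    apply: compact_closedI => //.
    apply: (@preimage_closed _ _ (dot v) [set y | y <= dot v v - e]).
      by move=> x _; exact: dot_continuous.
    exact: closed_le.
  apply/convex_setP => x y t [Px vx] [Py vy] t01; split.
    by move/convex_setP: cvP; exact.
  by have /convex_setP := @convex_halfspace R d v (dot v v - e); exact.
have /[swap]/[apply] : P' `<` P.
  split=> [|/(_ v Pv)[_ /=]]; first exact: subIsetl.
  by rewrite leNgt ltrBlDr ltrDl e0.
move=> /coveringP/existsNP[x nx].
have {}nx z : integer_lattice z -> ~ P' (x - z).
  by move=> zi Px; apply: nx; exists z.
have [z0 z0i Pxz0] := covP x.
have xz0 := near_v _ Pxz0 (nx _ z0i).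
exists (x - z0 - v); split=> [i|| z zi].
- by apply: lt_le_trans (xz0 i) _; rewrite ge_min lexx.
- by rewrite addrC subrK.
rewrite [v + _]addrC subrK => Pz.
have zz0 : integer_lattice (z0 + z) by move=> i; rewrite mxE rpredD.
have := nx _ zz0; rewrite opprD addrA => /(near_v _ Pz) xz.
apply/rowP => i; rewrite [RHS]mxE; apply/eqP; apply: contraT => zi0.
have := norm_intr_ge1 (zi i) zi0; rewrite leNgt => /negP[].
have -> : z ord0 i = (x - z0 - v) ord0 i - (x - z0 - z - v) ord0 i.
  by rewrite !mxE; ring.
have r'2 : r' <= 2^-1 by rewrite ge_min lexx orbT.
apply: le_lt_trans (ler_normB _ _) _.
by have := xz0 i; have := xz i; lra.
Qed.

Lemma leq_card_spanning (I : finType) (A : {set I}) (a : I -> 'rV[R]_d) :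
  (forall w, (forall i, i \in A -> dot (a i) w = 0) -> w = 0) -> (d <= #|A|)%N.
Proof.
move=> aw; pose M := (\matrix_(i < #|A|) a (enum_val i))^T.
have : row_free M.
  apply: inj_row_free => w /rowP wM; apply: aw => i Ai.
  have := wM (enum_rank_in Ai i); rewrite mxE [RHS]mxE => <-.
  rewrite dotC; apply: eq_bigr => j _.
  by rewrite !mxE enum_rankK_in.
by move=> /eqP <-; exact: rank_leq_col.
Qed.

End Local.

(** * The lower bound on the number of facets *)

Section LowerBound.
Local Open Scope ring_scope.
Variables (R : realType) (d : nat).
Implicit Types (P : set 'rV[R]_d) (u v w x z : 'rV[R]_d).

Lemma dot_addB v w : dot (v + w) (v + w) + dot (v - w) (v - w) =
  2 * dot v v + 2 * dot w w.
Proof. by rewrite !(dotDr, dotDl, dotNr, dotNl) (dotC w v); ring. Qed.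

(** Balls are convex, so a longest generator is longest in the hull. If the strict inequality failed
    everywhere, [dot (s i)] would be constant on the generators; then [s i = 0], all generators
    vanish, and they cannot span. *)
Lemma max_norm_vertex m (s : 'I_m -> 'rV[R]_d) :
  (0 < d)%N -> (0 < m)%N -> affinely_spanning s ->
  exists i, (forall x, convex_hull (range s) x -> dot x x <= dot (s i) (s i)) /\
    exists2 x, convex_hull (range s) x & dot (s i) x < dot (s i) (s i).
Proof.
move=> d0 m0 span.
case: (@Order.TotalTheory.arg_maxP _ R _ (Ordinal m0) xpredT
  (fun i => dot (s i) (s i)) isT) => i _ imax.
exists i; split.
  apply: convex_hull_min; first exact: convex_dot_ball.
  by move=> _ [j _ <-]; exact: imax.
apply: contrapT => allv.
have vs j : dot (s i) (s j) = dot (s i) (s i).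
  apply/eqP; rewrite eq_le; apply/andP; split.
    have := dot_ge0 (s i - s j).
    rewrite !(dotDr, dotDl, dotNr, dotNl) (dotC (s j)).
    by have /= := imax j isT; lra.
  rewrite leNgt; apply/negP => h; apply: allv; exists (s j) => //.
  by apply: sub_convex_hull; exists j.
have s0 j : s j = 0.
  apply/eqP; apply: contraT => /dot_gt0; rewrite ltNge => /negP[].
  by rewrite (le_trans (imax j isT))// (span _ _ vs) dot0l.
have /rowP/(_ (Ordinal d0)) : const_mx 1 = 0 :> 'rV[R]_d.
  by apply: (span _ 0) => j; rewrite s0 dot0r.
by rewrite !mxE => /eqP; rewrite oner_eq0.
Qed.

Lemma leq_card_facet_ineqs P (I : finType) (F : {set I})
    (f : I -> 'rV[R]_d * R) v :
  (forall x, P x <-> forall k, k \in F -> dot (f k).1 x <= (f k).2) ->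
  (forall k, k \in F -> (f k).1 != 0) ->
  minimal_covering P -> P v -> (forall x, P x -> dot x x <= dot v v) ->
  (exists2 x, P x & dot v x < dot v v) -> (2 * d <= #|F|)%N.
Proof.
move=> PE fn0 mP Pv vmax vx; have [[_ cP _] /coveringP covP _] := mP.
have [r r0 loc] := local_structure f v cP.
have [u [ur Pu uz]] := privately_covered_near mP Pv vmax vx r0.
pose A := [set k in F | 0 < dot (f k).1 u]%SET.
pose B := [set k in F | dot (f k).1 u < 0]%SET.
(* Suppose a translate by [z != 0] covers [v + u']. It does not cover [v + u], so [u] violates an
   inequality tight at [v - z]; its index lies in [A], so [u'] violates it too. *)
have inP u' : (forall i, `|u' ord0 i| < r) ->
    (forall k, k \in A -> 0 < dot (f k).1 u') -> P (v + u').
  move=> u'r u'A; have [z zi Pz] := covP (v + u').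
  have [z0|z0] := eqVneq z 0; first by move: Pz; rewrite z0 subr0.
  have [out' _] := loc _ u'r _ zi; have [_ slack] := loc _ ur _ zi.
  have zu' : v - z + u' = v + u' - z by rewrite addrAC.
  have zu : v - z + u = v + u - z by rewrite addrAC.
  have Pvz : P (v - z) by apply: contrapT => /out'; rewrite zu'.
  suff /uz : P (v + u - z) by move=> /(_ zi) z0'; rewrite z0' eqxx in z0.
  apply/PE => k kF; rewrite leNgt; apply/negP => ku.
  have /PE/(_ k kF) := Pvz; rewrite le_eqVlt.
  case/predU1P => [kt|/(slack Pvz)]; last first.
    by rewrite zu => /lt_trans/(_ ku); rewrite ltxx.
  have kA : k \in A by rewrite !inE kF; move: ku; rewrite -zu dotDr kt ltrDl.
  have /PE/(_ k kF) := Pz; rewrite -zu' dotDr kt gerDl leNgt.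
  by rewrite u'A.
(* By the parallelogram law, a nondegenerate segment centred at [v] has an endpoint longer than
   [v]. *)
have no_segment t w : 0 < t -> P (v + t *: w) -> P (v - t *: w) -> w = 0.
  move=> t0 /vmax h1 /vmax h2; apply/eqP; apply: contraT => /dot_gt0 w0.
  have := dot_addB v (t *: w); rewrite dotZl dotZr.
  have : 0 < t * (t * dot w w) by rewrite !mulr_gt0.
  by lra.
have dA : (d <= #|A|)%N.
  apply: (leq_card_spanning (a := fun k => (f k).1)) => w wA.
  apply/eqP; apply: contraT => /dot_gt0 w0.
  have r20 i : `|(0 : 'rV[R]_d) ord0 i| < r / 2 by rewrite mxE normr0 divr_gt0.
  near (0 : R)^'+ => t.
  have t0 : 0 < t by [].
  have tw i : `|t * w ord0 i| < r / 2.
    suff : forall i, `|(0 + t *: w) ord0 i| < r / 2.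
      by move=> /(_ i); rewrite add0r mxE.
    by near: t; exact: near_right_coord_lt.
  have ttw : 0 < t * (t * dot w w) by rewrite !mulr_gt0.
  (* [l] is chosen after [t], so small that the change [2 * l * dot v u] in the squared norm cannot
     cancel the gain [t * (t * dot w w)]. *)
  near (0 : R)^'+ => l.
  have l0 : 0 < l by [].
  have lu i : `|l * u ord0 i| < r / 2.
    suff : forall i, `|(0 + l *: u) ord0 i| < r / 2.
      by move=> /(_ i); rewrite add0r mxE.
    by near: l; exact: near_right_coord_lt.
  have ltw : 0 + l * (- (2 * dot v u)) < t * (t * dot w w).
    by near: l; exact: near_right_affine_lt.
  have luA k : k \in A -> 0 < l * dot (f k).1 u.
    by rewrite inE => /andP[_ ?]; rewrite mulr_gt0.
  have P1 : P (v + (l *: u + t *: w)).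
    apply: inP => [i|k kA]; last by rewrite dotDr !dotZr wA// mulr0 addr0 luA.
    rewrite !mxE (le_lt_trans (ler_normD _ _))//.
    by have := lu i; have := tw i; lra.
  have P2 : P (v + (l *: u - t *: w)).
    apply: inP => [i|k kA]; last by rewrite dotBr !dotZr wA// mulr0 subr0 luA.
    rewrite !mxE (le_lt_trans (ler_normB _ _))//.
    by have := lu i; have := tw i; lra.
  have := dot_addB (v + l *: u) (t *: w).
  move: (vmax _ P1) (vmax _ P2); rewrite !addrA => h1 h2.
  rewrite dotZl dotZr.
  have -> : dot (v + l *: u) (v + l *: u) =
      dot v v + l * (2 * dot v u) + l * (l * dot u u).
    by rewrite !(dotDr, dotDl, dotZl, dotZr) (dotC u v); ring.
  have : 0 <= l * (l * dot u u) by rewrite !mulr_ge0 ?dot_ge0 ?ltW.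
   lra.
(* Perturbing [u] slightly along the normal [a] keeps it positive on [A]. Tightness then yields
   [dot a u + t * dot a a <= 0], which excludes even [dot a u = 0]. *)
have tightB k : k \in F -> dot (f k).1 v = (f k).2 -> k \in B.
  move=> kF kv; rewrite inE kF/= ltNge; apply/negP => ku.
  pose a := (f k).1; near (0 : R)^'+ => t.
  have t0 : 0 < t by [].
  have /PE/(_ k kF) : P (v + (u + t *: a)).
    apply: inP; first by near: t; exact: near_right_coord_lt.
    suff h : forall k', k' \in A -> - dot (f k').1 u + t * - dot (f k').1 a < 0.
      by move=> k' /h; rewrite dotDr dotZr; lra.
    near: t; apply: filter_forall => k'.
    have [k'A|k'A] := boolP (k' \in A); last by near=> t.
    have k'u : - dot (f k').1 u < 0.
      by move: k'A; rewrite inE oppr_lt0 => /andP[].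
    have h := near_right_affine_lt (- dot (f k').1 a) k'u.
    by near=> t => _; near: t.
  rewrite !dotDr dotZr kv -/a.
  have : 0 < t * dot a a by rewrite mulr_gt0// dot_gt0// fn0.
  by lra.
have dB : (d <= #|B|)%N.
  apply: (leq_card_spanning (a := fun k => (f k).1)) => w wB.
  have slack w' : \forall t \near 0^'+, forall k, k \in F ->
      dot (f k).1 v < (f k).2 -> dot (f k).1 v + t * dot (f k).1 w' < (f k).2.
    apply: filter_forall => k.
    have [kv|kv] := ltP (dot (f k).1 v) (f k).2; last by near=> t'.
    have h := near_right_affine_lt (dot (f k).1 w') kv.
    by near=> t' => _ _; near: t'.
  near (0 : R)^'+ => t.
  have t0 : 0 < t by [].
  (* Inequalities tight at [v] belong to [B] and stay equalities; the others have slack for small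
     [t]. *)
  have inPt w' : (forall k, k \in B -> dot (f k).1 w' = 0) ->
      (forall k, k \in F -> dot (f k).1 v < (f k).2 ->
         dot (f k).1 v + t * dot (f k).1 w' < (f k).2) -> P (v + t *: w').
    move=> w'B w't; apply/PE => k kF; rewrite dotDr dotZr.
    have /PE/(_ k kF) := Pv; rewrite le_eqVlt => /predU1P[kv|/(w't k kF)/ltW//].
    by rewrite w'B ?mulr0 ?addr0 ?kv// tightB.
  apply: (no_segment t) => //.
    by apply: inPt => //; near: t; exact: slack.
  rewrite -scalerN; apply: inPt => [k kB|]; first by rewrite dotNr wB ?oppr0.
  by near: t; exact: slack.
have AB : #|A :&: B| = 0%N.
  apply/eqP; rewrite cards_eq0; apply/eqP/setP => k; rewrite !inE.
  by case: ltgtP => //=; rewrite ?andbF.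
rewrite mul2n -addnn (leq_trans (leq_add dA dB))// -cardsUI AB addn0.
apply: subset_leq_card; apply/fintype.subsetP => k.
by rewrite !inE => /orP[] /andP[].
Unshelve. all: by end_near. Qed.

Lemma card_facets_ge P : (0 < d)%N ->
  polytope P -> minimal_covering P -> `I_(2 * d) #<= facets P.
Proof.
move=> d0 [S [/finite_seqP[l ->] PS]] mP.
pose m := size l; pose s (i : 'I_m) := tnth (in_tuple l) i.
have {PS} PE : P = convex_hull (range s).
  rewrite PS; congr convex_hull; apply/seteqP; split=> x.
    by move=> /= /(tnthP (in_tuple l))[i ->]; exists i.
  by move=> [i _ <-]; exact: mem_tnth.
have [[[x0 Px0] _ _] covP _] := mP.
have m0 : (0 < m)%N.
  rewrite lt0n; apply/negP => /eqP m0.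
  have : (set0 : set 'rV[R]_d) x0; last by [].
  move: Px0; rewrite PE; apply: convex_hull_min.
    by move=> x y t; rewrite inE.
  by move=> x [i _ _]; have := leq_trans (ltn_ord i) (eq_leq m0).
have span : affinely_spanning s.
  move=> a c sc; apply: (covering_spanning covP) => x; rewrite PE => Px.
  apply/eqP; rewrite eq_le; apply/andP; split.
    apply: (convex_hull_min (@convex_halfspace _ _ a c)) Px.
    by move=> _ [i _ <-] /=; rewrite sc.
  rewrite -lerN2 -dotNl.
  apply: (convex_hull_min (@convex_halfspace _ _ (- a) (- c))) Px.
  by move=> _ [i _ <-] /=; rewrite dotNl sc.
have [F [f [Ff FP]]] := finite_facet_description m0 span.
have [i [imax ix]] := max_norm_vertex d0 m0 span.
have Ps j : P (s j) by rewrite PE; apply: sub_convex_hull; exists j.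
have Fge : (2 * d <= #|F|)%N.
  apply: (@leq_card_facet_ineqs P _ F f (s i)) => //; rewrite ?PE//.
    move=> x; split; last exact: FP.
    move=> Px J JF; have [[fs _ _] _] := Ff J JF.
    apply: (convex_hull_min (@convex_halfspace _ _ (f J).1 (f J).2)) Px.
    by move=> _ [j _ <-]; exact: fs.
  by move=> J /Ff[[]].
pose face_of J := [set x | P x /\ dot (f J).1 x = (f J).2].
(* A face determines which generators it contains, hence its index. *)
have face_inj J J' : J \in F -> J' \in F -> face_of J = face_of J' -> J = J'.
  move=> /Ff[_ JE] /Ff[_ JE'] JJ'; rewrite -JE -JE'.
  apply/setP => j; rewrite !inE.
  have : face_of J (s j) <-> face_of J' (s j) by rewrite JJ'.
  by move=> [h1 h2]; apply/eqP/eqP => h; [case: h1|case: h2].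
pose h k := face_of (nth finset.set0 (enum F) k).
have hF k : `I_(2 * d) k -> nth finset.set0 (enum F) k \in F.
  by move=> kd; rewrite -mem_enum mem_nth// -cardE (leq_trans kd).
have hinj : {in `I_(2 * d) &, injective h}.
  move=> k k'; rewrite !inE => kd k'd /(face_inj _ _ (hF _ kd) (hF _ k'd)).
  move=> /eqP; rewrite nth_uniq ?enum_uniq -?cardE ?(leq_trans kd)//.
    by move=> /eqP.
  by rewrite (leq_trans k'd).
rewrite -(card_le_eql (inj_card_eq hinj)); apply: subset_card_le => _ [k kd <-].
have [fJ _] := Ff _ (hF _ kd).
by have := facet_of_facet_ineq span fJ; rewrite -PE.
Qed.

End LowerBound.

(** * Sharpness: the unit cube *)

Section Cube.
Local Open Scope ring_scope.
Variables (R : realType) (d : nat).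
Implicit Types (S K F : set 'rV[R]_d) (a p x y z : 'rV[R]_d).

Definition cube : set 'rV[R]_d := [set x | forall i, 0 <= x ord0 i <= 1].

Definition set_coord x i (t : R) : 'rV[R]_d :=
  \row_j (if j == i then t else x ord0 j).

Lemma dot_set_coord a x i t :
  dot a (set_coord x i t) = dot a x + a ord0 i * (t - x ord0 i).
Proof.
have -> : set_coord x i t = x + (t - x ord0 i) *: delta_mx ord0 i.
  apply/rowP => j; rewrite !mxE eqxx/=; case: eqP => [->|_]/=; ring.
by rewrite dotDr dotZr dot_delta mulrC.
Qed.

Lemma cube_set_coord x i t : cube x -> 0 <= t <= 1 -> cube (set_coord x i t).
Proof. by move=> cx t01 j; rewrite mxE; case: eqP. Qed.

Lemma convex_cube : convex_set cube.
Proof.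
apply/convex_setP => x y t cx cy /andP[t0 t1] i; rewrite !mxE.
have /andP[x0 x1] := cx i; have /andP[y0 y1] := cy i.
by apply/andP; split; nra.
Qed.

Definition cube_vertex (y : 'rV[bool]_d) : 'rV[R]_d :=
  map_mx (fun b : bool => b%:R) y.

Lemma cube_convex_hull : cube = convex_hull (range cube_vertex).
Proof.
apply/seteqP; split=> [x|]; last first.
  apply: convex_hull_min; first exact: convex_cube.
  by move=> _ [y _ <-] i; rewrite mxE; case: (y _ _); rewrite ?lexx ?ler01.
move=> cx C [/convex_setP cC sC].
(* Only the first [k] coordinates may be fractional; [k = d] imposes nothing. The induction splits
   [x] along one coordinate. *)
suff h k : forall x, cube x ->
    (forall i : 'I_d, (k <= i)%N -> x ord0 i = 0 \/ x ord0 i = 1) -> C x.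
  by apply: (h d) => // i; rewrite leqNgt ltn_ord.
elim: k {x cx} => [|k IH] x cx xk.
  apply: sC; exists (\row_i (x ord0 i == 1)) => //.
  apply/rowP => i; rewrite !mxE.
  by case: (xk i isT) => ->; rewrite ?eqxx// eq_sym oner_eq0.
have [kd|dk] := ltnP k d; last first.
  apply: IH => // i ki.
  by have := leq_trans (ltn_ord i) (leq_trans dk ki); rewrite ltnn.
pose i0 := Ordinal kd.
have C01 t : t = 0 \/ t = 1 -> C (set_coord x i0 t).
  move=> t01; apply: IH => [|i].
    by apply: cube_set_coord => //; case: t01 => ->; rewrite ?lexx ?ler01.
  rewrite mxE leq_eqVlt => /predU1P[ki|ki].
    by rewrite ifT//; apply/eqP/val_inj.
  by case: ifP => // _; exact: xk.
have -> : x =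
    x ord0 i0 *: set_coord x i0 1 + (1 - x ord0 i0) *: set_coord x i0 0.
  apply/rowP => i; rewrite !mxE; case: eqP => [->|_]; ring.
by apply: cC; [apply: C01; right|apply: C01; left|exact: cx].
Qed.

Lemma polytope_cube : polytope cube.
Proof.
exists (range cube_vertex); split; last exact: cube_convex_hull.
exact/finite_image/finite_finset.
Qed.

Lemma convex_body_cube : convex_body cube.
Proof.
split; [by exists 0 => i; rewrite mxE lexx ler01| |exact: convex_cube].
have := @rV_compact _ d (fun=> `[0, 1 : R]%classic)
  (fun=> @segment_compact R 0 1).
by congr compact; apply/seteqP; split=> x cx i; have := cx i; rewrite /= in_itv.
Qed.

Lemma covering_cube : covering cube.
Proof.
apply/coveringP => x; exists (map_mx (fun t => (Num.floor t)%:~R) x).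
  by move=> i; rewrite mxE intr_int.
move=> i; rewrite !mxE.
have := floor_le (x ord0 i); have := floorD1_gt (x ord0 i).
by rewrite intrD => h1 h2; apply/andP; split; lra.
Qed.

Lemma minimal_covering_cube : minimal_covering cube.
Proof.
split; [exact: convex_body_cube|exact: covering_cube|].
move=> K [_ cK _] [Kc ncK] /coveringP covK; apply: ncK => x cx.
(* A point of the cube differs from an interior point by less than 1 in each coordinate, so the
   covering vector is 0. *)
have intK y : (forall i, 0 < y ord0 i < 1) -> K y.
  move=> y01; have [z zi Kyz] := covK y.
  suff z0 : z = 0 by rewrite z0 subr0 in Kyz.
  apply/rowP => i; rewrite [RHS]mxE; apply/eqP; apply: contraT => zi0.
  have := norm_intr_ge1 (zi i) zi0; rewrite leNgt => /negP[].
  have := Kc _ Kyz i; have := y01 i; rewrite !mxE ltr_norml.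
  by move=> /andP[? ?] /andP[? ?]; apply/andP; split; lra.
apply: contrapT => nKx.
have oK : nbhs x (~` K).
  apply: open_nbhs_nbhs; split=> //; apply: closed_openC.
  exact: compact_closed (@norm_hausdorff _ _) cK.
have [r r0 rK] := near0_coord (near0_translate oK).
have r00 i : `|(0 : 'rV[R]_d) ord0 i| < r by rewrite mxE normr0.
near (0 : R)^'+ => t.
have t0 : 0 < t by [].
have t1 : t < 1 by near: t; exact: nbhs_right_lt.
(* Moving [x] slightly towards the centre lands in the open cube, hence in [K], yet near [x]. *)
apply: (rK (0 + t *: (const_mx 2^-1 - x))).
  by near: t; exact: near_right_coord_lt.
apply: intK => i; rewrite !mxE; have /andP[x0 x1] := cx i.
by apply/andP; split; nra.
Unshelve. all: by end_near. Qed.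

Lemma affine_hull_hyperplane S a (b : R) : a != 0 ->
  (forall x, S x -> dot a x = b) -> forall x, affine_hull S x -> dot a x = b.
Proof.
move=> a0 Sb; have [V [VE _]] := hyperplane_vspace a0.
have flatE x : flat ((b / dot a a) *: a) V x <-> dot a x = b.
  rewrite /flat/= VE dotBr dotZr divfK ?lt0r_neq0 ?dot_gt0// subr_eq0.
  by split=> /eqP.
move=> x; move/(_ (flat ((b / dot a a) *: a) V)) => h; apply/flatE/h; split.
  by exists ((b / dot a a) *: a), V.
by move=> y /Sb/flatE.
Qed.

(** The affine hull of the empty set lies in every singleton flat, so a point [p] in it would equal
    every point of the space. *)
Lemma has_dim_neq0 S k : (0 < d)%N -> has_dim S k -> S !=set0.
Proof.
move=> d0 [p [V [SV _]]]; apply/set0P/negP => /eqP S0.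
have pq q : p = q.
  have : affine_hull S p by rewrite SV /flat/= subrr mem0v.
  move=> /(_ (flat q 0%VS)); rewrite /flat/= memv0 subr_eq0 => h; apply/eqP/h.
  by split; [exists q, 0%VS|rewrite S0 => ?].
have /rowP/(_ (Ordinal d0)) : const_mx 0 = const_mx 1 :> 'rV[R]_d.
  by rewrite -[LHS]pq -[RHS]pq.
by rewrite !mxE => /eqP; rewrite eq_sym oner_eq0.
Qed.

Definition cube_face (ib : 'I_d * bool) : set 'rV[R]_d :=
  [set x | cube x /\ x ord0 ib.1 = ib.2%:R].

(** A coordinate with [a ord0 i != 0] is constant on [F], so the affine hull of [F] lies in a
    coordinate hyperplane and equals it by dimension. Hence [F] is the whole cube face there. *)
Lemma facets_cube : (0 < d)%N -> facets cube `<=` range cube_face.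
Proof.
move=> d0 F [[a [b [ab FE]]] [k [cubek Fk]]].
have full : has_dim cube d.
  by apply: has_dim_full => a' c; exact: covering_spanning covering_cube.
have kd := has_dim_inj cubek full.
(* If [a = 0], the nonempty [F] would be the whole cube, of too large a dimension. *)
have [i ai] : exists i, a ord0 i != 0.
  apply/rV0Pn; apply/eqP => a0; have [x] := has_dim_neq0 d0 Fk.
  rewrite FE /= a0 dot0l => -[_ b0].
  have cF : cube = F.
    by rewrite FE; apply/seteqP; split=> [y cy|y []//]; rewrite /= a0 dot0l.
  by move: Fk; rewrite -cF => /(has_dim_inj full) dk; move: kd; lia.
(* [e] is the endpoint that maximizes [dot a] in coordinate [i]; elsewhere, moving to [e] would
   increase [dot a]. *)
exists (i, 0 < a ord0 i) => //; set e : R := (0 < a ord0 i)%R%:R.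
have e01 : 0 <= e <= 1 by rewrite /e; case: (_ < _); rewrite ?lexx ?ler01.
have Fe x : F x -> x ord0 i = e.
  rewrite FE => -[cx ax]; apply/eqP; apply: contraT => xe.
  have := ab _ (cube_set_coord i cx e01); rewrite dot_set_coord ax gerDl leNgt.
  move=> /negP[]; have /andP[x0 x1] := cx i; move: xe; rewrite /e.
  case: ltgtP ai => //= ai _ xe.
    by rewrite pmulr_rgt0// subr_gt0 lt_neqAle xe.
  by rewrite nmulr_rgt0// sub0r oppr_lt0 lt_neqAle eq_sym xe.
have i0 : delta_mx ord0 i != 0 :> 'rV[R]_d.
  by apply/rV0Pn; exists i; rewrite mxE !eqxx oner_neq0.
have a0 : a != 0 by apply/rV0Pn; exists i.
have [W [WE dW]] := hyperplane_vspace i0.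
have [p [V [FV dV]]] := Fk.
have coordE x : dot (delta_mx ord0 i) x = x ord0 i by rewrite dotC dot_delta.
have affe x : flat p V x -> x ord0 i = e.
  rewrite -FV -coordE; apply: affine_hull_hyperplane => // y Fy.
  by rewrite coordE Fe.
have pe : p ord0 i = e by apply: affe; rewrite /flat/= subrr mem0v.
have VW : V = W.
  apply/eqP; rewrite eqEdim; apply/andP; split; last first.
    by move: dW kd; rewrite dV; lia.
  apply/subvP => y Vy; rewrite WE coordE.
  have := affe (y + p); rewrite /flat/= addrK mxE pe => /(_ Vy).
  by move=> /eqP; rewrite -subr_eq0 addrK.
rewrite FE; apply/seteqP; split=> x [cx xe]; split=> //; last first.
  by apply: Fe; rewrite FE.
apply: (@affine_hull_hyperplane F) => // [y|]; first by rewrite FE => -[].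
by rewrite FV /flat/= VW WE coordE !mxE xe pe subrr.
Qed.

Lemma card_facets_cube : (0 < d)%N -> facets cube #<= `I_(2 * d).
Proof.
move=> d0; have /card_le_trans := subset_card_le (facets_cube d0); apply.
apply: (@card_le_trans _ _ _ [set: 'I_#|{: 'I_d * bool}|]).
  pose g (j : 'I_#|{: 'I_d * bool}|) := cube_face (enum_val j).
  have -> : range cube_face = range g.
    apply/seteqP; split=> _ [x _ <-]; last by exists (enum_val x).
    by exists (enum_rank x) => //; rewrite /g enum_rankK.
  exact: card_image_le.
rewrite -(card_le_eql card_II) card_le_II card_prod card_bool card_ord.
by rewrite mulnC.
Qed.


End Cube.

Theorem theorem2p7 (R : realType) (d : nat) (hd : (1 <= d)%N) :
  (forall P : set 'rV[R]_d, polytope P -> minimal_covering P ->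
     `I_(2 * d) #<= facets P) /\
  (exists P : set 'rV[R]_d,
     [/\ polytope P, minimal_covering P & facets P #= `I_(2 * d)]).
Proof.
have lower P := @card_facets_ge R d P hd.
split=> //; exists (@cube R d).
split; [exact: polytope_cube|exact: minimal_covering_cube|].
(* The opposite estimate is the lower bound applied to the cube itself. *)
apply/card_eqPle; split; first exact: card_facets_cube.
by apply: lower; [exact: polytope_cube|exact: minimal_covering_cube].
Qed.
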